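(* Let $k$ be an arbitrary field (of any characteristic), let $n$ be a positive integer, and let $$I=\langle x^3,\ y^3,\ x^2y,\ x^2z^n-xy^2\rangle$$ be an ideal in the polynomial ring $k[x,y,z]$. Then the ideal $I$ is primary, and its integral closure is $$\bar I=\langle x^3,\ y^3,\ x^2y,\ x^2z^n,\ xy^2\rangle,$$ which is not primary.
   Context: For an ideal $I$ of a commutative ring $R$, an element $r\in R$ is integral over $I$ if there exist an integer $m\ge 1$ and elements $a_i\in I^i$, $i=1,\dots,m$, such that $r^m+a_1r^{m-1}+\cdots+a_{m-1}r+a_m=0$. The integral closure $\bar I$ of $I$ is the set of all elements of $R$ integral over $I$. *)

(* Defs.v *)
From mathcomp Require Import all_boot all_algebra.
From mathcomp Require Import mpoly.

Set Implicit Arguments.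
Unset Strict Implicit.
Unset Printing Implicit Defensive.

Import GRing.Theory.
Local Open Scope ring_scope.

(* Subsets of R are Prop-valued here: [idealr_closed] and [prime_idealr_closed]
   of ring_quotient are about boolean predicates, whereas neither membership in
   a generated ideal nor integrality is given by a boolean test. *)

Definition is_ideal (R : comNzRingType) (I : R -> Prop) : Prop :=
  [/\ I 0,
      forall a b, I a -> I b -> I (a + b)
    & forall r a, I a -> I (r * a)].

Definition ideal_gen (R : comNzRingType) (s : seq R) : R -> Prop :=
  fun r => exists c : 'I_(size s) -> R, r = \sum_(i < size s) c i * s`_i.

Definition ideal_mul (R : comNzRingType) (I J : R -> Prop) : R -> Prop :=
  fun r => exists (m : nat) (a b : 'I_m -> R),
    [/\ forall i, I (a i), forall i, J (b i) & r = \sum_(i < m) a i * b i].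

Fixpoint ideal_exp (R : comNzRingType) (I : R -> Prop) (m : nat) : R -> Prop :=
  if m is m'.+1 then ideal_mul I (ideal_exp I m') else fun _ => True.

Definition integral_over_ideal (R : comNzRingType) (I : R -> Prop) (r : R) :
    Prop :=
  exists (m : nat) (a : nat -> R),
    [/\ (1 <= m)%N,
        forall i, (1 <= i <= m)%N -> ideal_exp I i (a i)
      & r ^+ m + \sum_(1 <= i < m.+1) a i * r ^+ (m - i) = 0].

Definition integral_closure (R : comNzRingType) (I : R -> Prop) : R -> Prop :=
  fun r => integral_over_ideal I r.

Definition primary_ideal (R : comNzRingType) (Q : R -> Prop) : Prop :=
  [/\ is_ideal Q,
      ~ Q 1
    & forall a b, Q (a * b) -> Q a \/ exists m : nat, (1 <= m)%N /\ Q (b ^+ m)].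

(* Hence a generated ideal can fail [primary_ideal] only through properness or
   the condition on products. *)
Lemma ideal_gen_is_ideal (R : comNzRingType) (s : seq R) :
  is_ideal (ideal_gen s).
Proof.
split.
- by exists (fun=> 0); rewrite big1 // => i _; rewrite mul0r.
- move=> a b [c ->] [d ->]; exists (fun i => c i + d i).
  by rewrite -big_split; apply: eq_bigr => i _; rewrite mulrDl.
- move=> r a [c ->]; exists (fun i => r * c i).
  by rewrite mulr_sumr; apply: eq_bigr => i _; rewrite mulrA.
Qed.

(* Main.v *)
From HB Require Import structures.
Require Import Defs.
From mathcomp Require Import all_boot all_algebra.
From mathcomp Require Import mpoly.
From mathcomp Require Import ring zify.

Set Implicit Arguments.
Unset Strict Implicit.
Unset Printing Implicit Defensive.

Import GRing.Theory.
Local Open Scope ring_scope.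

(** Write p as the sum of p_ij(z) x^i y^j. Modulo I every p reduces to a
    k[z]-combination of 1, x, y, x^2, xy, y^2 (since xy^2 = z^n x^2 modulo I),
    and R/I is free over k[z] on these six classes: p lies in I iff
    p_00 = p_10 = p_01 = p_11 = p_02 = 0 and p_20 + z^n p_12 = 0. As x and y
    are nilpotent modulo I, an element q with q_00 <> 0 is a non-zero-divisor
    on R/I, while q_00 = 0 forces q^4 to lie in I; so I is primary.

    For the integral closure, (xy^2)^2 = (x^2 y) y^3 lies in I^2, so I + (xy^2)
    is integral over I. Conversely, that monomial ideal is cut out by the two
    monomial valuations of weights (3,2,0) and (n,n,1), with bounds 6 and 3n,
    and such valuation conditions survive integral closure. The monomial
    x^2 z^n shows that it is not primary. *)

(** * Generated ideals and squares of ideals *)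

Lemma ideal_gen_mem (R : comNzRingType) (s : seq R) g :
  g \in s -> ideal_gen s g.
Proof.
move=> gs; have lt_gs : (index g s < size s)%N by rewrite index_mem.
exists (fun i => (i == Ordinal lt_gs)%:R).
rewrite (bigD1 (Ordinal lt_gs)) //= eqxx mul1r nth_index // big1 ?addr0 //.
by move=> i /negbTE ->; rewrite mul0r.
Qed.

Lemma is_ideal_sum (R : comNzRingType) (Q : R -> Prop) (T : eqType)
    (r : seq T) (F : T -> R) :
  is_ideal Q -> (forall t, t \in r -> Q (F t)) -> Q (\sum_(t <- r) F t).
Proof. by case=> Q0 QD _ QF; rewrite big_seq; apply: big_ind. Qed.

Lemma ideal_gen_sub (R : comNzRingType) (s : seq R) (Q : R -> Prop) :
  is_ideal Q -> (forall g, g \in s -> Q g) -> forall r, ideal_gen s r -> Q r.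
Proof.
move=> idQ sQ _ [c ->]; apply: is_ideal_sum => // i _.
by case: idQ => _ _; apply; apply: sQ; rewrite mem_nth.
Qed.

Lemma ideal_mulI (R : comNzRingType) (I J : R -> Prop) a b :
  I a -> J b -> ideal_mul I J (a * b).
Proof.
by move=> Ia Jb; exists 1, (fun=> a), (fun=> b); split; rewrite ?big_ord1.
Qed.

Lemma ideal_exp1 (R : comNzRingType) (I : R -> Prop) a :
  I a -> ideal_exp I 1 a.
Proof. by move=> Ia; rewrite -[a]mulr1; apply: ideal_mulI. Qed.

Lemma ideal_exp2 (R : comNzRingType) (I : R -> Prop) a b :
  I a -> I b -> ideal_exp I 2 (a * b).
Proof. by move=> Ia Ib; apply: ideal_mulI => //; apply: ideal_exp1. Qed.

Lemma ideal_exp2_is_ideal (R : comNzRingType) (I : R -> Prop) :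
  is_ideal I -> is_ideal (ideal_exp I 2).
Proof.
case=> I0 ID IM; split.
- by exists 0, (fun=> 0), (fun=> 0); split; [case|case|rewrite big_ord0].
- move=> _ _ [m1 [a1 [b1 [Ia1 Ib1 ->]]]] [m2 [a2 [b2 [Ia2 Ib2 ->]]]].
  exists (m1 + m2)%N,
    (fun i => match split i with inl j => a1 j | inr j => a2 j end),
    (fun i => match split i with inl j => b1 j | inr j => b2 j end).
  split; try by move=> i; case: (split i).
  rewrite big_split_ord; congr (_ + _); apply: eq_bigr => i _.
    by rewrite (unsplitK (inl i)).
  by rewrite (unsplitK (inr i)).
move=> r _ [m [a [b [Ia Ib ->]]]].
exists m, (fun i => r * a i), b; split=> // [i|]; first exact: IM.
by rewrite mulr_sumr; apply: eq_bigr => i _; rewrite mulrA.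
Qed.

(** The element u + v is a root of (T - u)^2 - v^2, whose coefficients -2u and u^2 - v^2 lie in I
    and I^2. *)
Lemma integral_sqr_add (R : comNzRingType) (I : R -> Prop) u v :
  is_ideal I -> I u -> ideal_exp I 2 (v ^+ 2) -> integral_closure I (u + v).
Proof.
move=> idI Iu Iv; have [_ _ IM] := idI.
have [_ I2D I2M] := ideal_exp2_is_ideal idI.
exists 2, (fun i => if i == 1 then - 2 * u else u * u + (-1) * v ^+ 2).
split=> // [[|[|[|]]] //= _|].
- by apply: ideal_exp1; apply: IM.
- by apply: I2D; [apply: ideal_exp2 | apply: I2M].
by rewrite big_nat_recr // big_nat1 /=; ring.
Qed.

(** * Monomial valuations and integral dependence *)

Lemma dvd_XnM_integral (D : idomainType) (N : nat) (P : {poly D}) m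
    (A : nat -> {poly D}) :
  (0 < m)%N ->
  (forall i, (1 <= i <= m)%N -> exists B, A i = 'X^(N * i) * B) ->
  P ^+ m + \sum_(1 <= i < m.+1) A i * P ^+ (m - i) = 0 ->
  exists Q, P = 'X^N * Q.
Proof.
move=> m0 hA eqP.
(* If T^e exactly divides P with e < N, every term A_i P^(m-i) vanishes at 0
   to order greater than e m, but P^m does not. *)
suff: forall e, (e <= N)%N -> exists Q, P = 'X^e * Q by apply.
elim=> [_|e IHe lt_eN]; first by exists P; rewrite mul1r.
have [Q defP] := IHe (ltnW lt_eN).
have [C hC] : exists C, \sum_(1 <= i < m.+1) A i * P ^+ (m - i)
    = 'X^(e * m) * ('X * C).
  rewrite big_seq; elim/big_ind: _ => [|_ _ [C1 ->] [C2 ->]|i].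
  - by exists 0; rewrite !mulr0.
  - by exists (C1 + C2); ring.
  rewrite mem_index_iota ltnS => /[dup] /andP[i0 le_im] /hA[B ->].
  (* As e < N and i >= 1, the coefficient A_i brings at least one factor T beyond the e i factors
     that P^i would supply. *)
  have [c ->] : exists c, (N * i = e * i + c.+1)%N.
    by exists ((N - e) * i).-1; nia.
  exists ('X^c * B * Q ^+ (m - i)).
  rewrite defP exprMn -exprM -{3}(subnKC le_im) mulnDr !exprD exprS; ring.
(* Cancelling T^(e m) and evaluating at 0 gives Q(0)^m = 0, so T divides Q. *)
move: eqP; rewrite hC {1}defP exprMn -exprM -mulrDr => /eqP.
rewrite mulf_eq0 expf_eq0 polyX_eq0 andbF /= => /eqP eq0.
have: (Q ^+ m + 'X * C).[0] = 0 by rewrite eq0 horner0.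
rewrite hornerD horner_exp hornerM hornerX mul0r addr0 => /eqP.
rewrite expf_eq0 m0 /= => /factor_theorem[Q' defQ].
by exists Q'; rewrite defP defQ polyC0 subr0 exprSr; ring.
Qed.

Definition wt r (w : 'I_r -> nat) (m : 'X_{1..r}) : nat :=
  (\sum_(i < r) w i * m i)%N.

(* Substitutes X_i T^(w i) for X_i, so that the monomial valuation of weight w
   becomes the order of vanishing at T = 0. *)
Definition wsubst (D : comNzRingType) r (w : 'I_r -> nat) (p : {mpoly D[r]}) :
    {poly {mpoly D[r]}} :=
  mmap (polyC \o @mpolyC r D) (fun i => ('X_i)%:P * 'X^(w i)) p.

HB.instance Definition _ (D : comNzRingType) r (w : 'I_r -> nat) :=
  GRing.RMorphism.copy (@wsubst D r w)
   (mmap (polyC \o @mpolyC r D) (fun i => ('X_i)%:P * 'X^(w i))).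

Lemma wsubstX (D : comNzRingType) r (w : 'I_r -> nat) i :
  wsubst w ('X_i : {mpoly D[r]}) = ('X_i)%:P * 'X^(w i).
Proof. by rewrite /wsubst mmapX mmap1U. Qed.

(** Every monomial survives the substitution and merely gains a power of T, so distinct monomials of
    equal weight cannot cancel. *)
Lemma wsubst_coef (D : comNzRingType) r (w : 'I_r -> nat) (p : {mpoly D[r]}) m :
  ((wsubst w p)`_(wt w m))@_m = p@_m.
Proof.
have -> : wsubst w p =
    \sum_(l <- msupp p) (p@_l *: 'X_[l])%:P * 'X^(wt w l).
  apply: eq_bigr => l _; rewrite /= -mul_mpolyC polyCM -mulrA; congr (_ * _).
  rewrite mpolyXE_id rmorph_prod /mmap1 /wt.
  rewrite expr_sum -big_split /=; apply: eq_bigr => i _.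
  by rewrite exprMn rmorphXn /= exprM.
rewrite [in RHS](mpolyE p) coef_sum !raddf_sum /=; apply: eq_bigr => l _.
rewrite coefCM coefXn mcoeffZ mcoeffX.
have [->|ne_lm] := eqVneq l m; first by rewrite eqxx mulr1 mcoeffZ mcoeffX eqxx.
case: eqP => _; last by rewrite !mulr0 mcoeff0.
by rewrite mulr1 mcoeffZ mcoeffX (negbTE ne_lm).
Qed.

(** Divisibility by T^N says that the valuation is at least N without assigning a value to 0. *)
Definition ord_ge (D : comNzRingType) r (w : 'I_r -> nat) (N : nat)
    (p : {mpoly D[r]}) : Prop :=
  exists Q, wsubst w p = 'X^N * Q.

Lemma ord_ge_is_ideal (D : comNzRingType) r (w : 'I_r -> nat) N :
  is_ideal (@ord_ge D r w N).
Proof.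
split.
- by exists 0; rewrite rmorph0 mulr0.
- by move=> a b [P hP] [Q hQ]; exists (P + Q); rewrite rmorphD /= hP hQ mulrDr.
by move=> a b [P hP]; exists (wsubst w a * P); rewrite rmorphM /= hP mulrCA.
Qed.

Lemma ord_ge_msupp (D : comNzRingType) r (w : 'I_r -> nat) N
    (p : {mpoly D[r]}) m :
  ord_ge w N p -> m \in msupp p -> (N <= wt w m)%N.
Proof.
case=> Q hQ; rewrite mcoeff_msupp -(wsubst_coef w) hQ coefXnM leqNgt.
by case: ltnP => // _; rewrite mcoeff0 eqxx.
Qed.

Lemma ord_ge_exp (D : comNzRingType) r (w : 'I_r -> nat) N
    (I : {mpoly D[r]} -> Prop) i p :
  (forall q, I q -> ord_ge w N q) -> ideal_exp I i p -> ord_ge w (N * i) p.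
Proof.
move=> IN; elim: i p => [|i IHi] p.
  by exists (wsubst w p); rewrite muln0 mul1r.
case=> m [a [b [Ia Ib ->]]].
refine (is_ideal_sum (@ord_ge_is_ideal D r w _) _) => j _.
have [P hP] := IN _ (Ia j); have [Q hQ] := IHi _ (Ib j).
by exists (P * Q); rewrite rmorphM /= hP hQ mulnS exprD; ring.
Qed.

(** The ring morphism [wsubst w] carries an equation of integral dependence to one whose i-th
    coefficient is divisible by T^(N i), where [dvd_XnM_integral] applies. *)
Lemma ord_ge_integral (D : idomainType) r (w : 'I_r -> nat) N
    (I : {mpoly D[r]} -> Prop) p :
  (forall q, I q -> ord_ge w N q) -> integral_closure I p -> ord_ge w N p.
Proof.
move=> IN [m [a [m0 Ia eq0]]].
apply: (@dvd_XnM_integral _ N _ m (fun i => wsubst w (a i))) => //.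
  by move=> i /Ia /(ord_ge_exp IN).
rewrite -[RHS](rmorph0 (wsubst w)) -eq0 rmorphD rmorphXn rmorph_sum /=.
by congr (_ + _); apply: eq_bigr => i _; rewrite rmorphM rmorphXn.
Qed.

(** * Coefficients in k[z] of the monomials in x and y *)

(* The outer variable is x, the middle one y and the inner one z. *)
Definition xytower (k : fieldType) (p : {mpoly k[3]}) :
    {poly {poly {poly k}}} :=
  mmap (polyC \o polyC \o polyC)
    (fun i : 'I_3 => [:: 'X; 'X%:P; 'X%:P%:P]`_i) p.

Lemma xytower_additive (k : fieldType) : additive (@xytower k).
Proof. exact: mmap_is_additive. Qed.

Lemma xytower_multiplicative (k : fieldType) : multiplicative (@xytower k).
Proof. exact: mmap_is_multiplicative. Qed.

HB.instance Definition _ (k : fieldType) :=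
  GRing.isAdditive.Build _ _ (@xytower k) (@xytower_additive k).
HB.instance Definition _ (k : fieldType) :=
  GRing.isMultiplicative.Build _ _ (@xytower k) (@xytower_multiplicative k).

Definition xycoef (k : fieldType) i j (p : {mpoly k[3]}) : {poly k} :=
  (xytower p)`_i`_j.

Lemma xycoefD (k : fieldType) i j (p q : {mpoly k[3]}) :
  xycoef i j (p + q) = xycoef i j p + xycoef i j q.
Proof. by rewrite /xycoef rmorphD /= !coefD. Qed.

Lemma xycoefM (k : fieldType) i j (p q : {mpoly k[3]}) :
  xycoef i j (p * q) = \sum_(a < i.+1) \sum_(b < j.+1)
    xycoef a b p * xycoef (i - a) (j - b) q.
Proof.
rewrite /xycoef rmorphM /= coefM coef_sum.
by apply: eq_bigr => a _; rewrite coefM.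
Qed.

Definition embz (k : fieldType) (A : {poly k}) : {mpoly k[3]} :=
  (map_poly (@mpolyC 3 k) A).['X_2].

HB.instance Definition _ (k : fieldType) :=
  GRing.RMorphism.copy (@embz k)
    (horner_eval ('X_2 : {mpoly k[3]}) \o map_poly (@mpolyC 3 k)).

Lemma xytowerX (k : fieldType) (i : 'I_3) :
  xytower ('X_i : {mpoly k[3]}) = [:: 'X; 'X%:P; 'X%:P%:P]`_i.
Proof. by rewrite /xytower mmapX mmap1U. Qed.

Lemma xytower_embz (k : fieldType) (A : {poly k}) :
  xytower (embz A) = A%:P%:P.
Proof.
elim/poly_ind: A => [|A c IHA]; first by rewrite !rmorph0.
rewrite !rmorphD !rmorphM /= IHA /embz map_polyX hornerX xytowerX /=.
by rewrite map_polyC hornerC /xytower mmapC.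
Qed.

Lemma xycoef_monomial (k : fieldType) a b i j (A : {poly k}) :
  xycoef a b (embz A * 'X_0 ^+ i * 'X_1 ^+ j) =
    if (a == i) && (b == j) then A else 0.
Proof.
rewrite /xycoef !rmorphM !rmorphXn /= xytower_embz !xytowerX /=.
rewrite mulrAC -polyC_exp -polyCM coefCM coefXn.
case: eqP => _; last by rewrite mulr0 coef0.
by rewrite mulr1 coefCM coefXn; case: eqP; rewrite ?mulr1 ?mulr0.
Qed.

(** * The membership criterion for I *)

Definition gensI (k : fieldType) n : seq {mpoly k[3]} :=
  [:: 'X_0 ^+ 3; 'X_1 ^+ 3; 'X_0 ^+ 2 * 'X_1;
      'X_0 ^+ 2 * 'X_2 ^+ n - 'X_0 * 'X_1 ^+ 2].

Definition gensJ (k : fieldType) n : seq {mpoly k[3]} :=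
  [:: 'X_0 ^+ 3; 'X_1 ^+ 3; 'X_0 ^+ 2 * 'X_1;
      'X_0 ^+ 2 * 'X_2 ^+ n; 'X_0 * 'X_1 ^+ 2].

Definition critI (k : fieldType) n (p : {mpoly k[3]}) : Prop :=
  [/\ xycoef 0 0 p = 0, xycoef 1 0 p = 0, xycoef 0 1 p = 0,
      xycoef 1 1 p = 0 /\ xycoef 0 2 p = 0
    & xycoef 2 0 p + 'X^n * xycoef 1 2 p = 0].

Lemma critI_is_ideal (k : fieldType) n : is_ideal (@critI k n).
Proof.
split.
- by rewrite /critI /xycoef rmorph0 !coef0 mulr0 addr0.
- move=> a b [a00 a10 a01 [a11 a02] a20] [b00 b10 b01 [b11 b02] b20].
  rewrite /critI !xycoefD a00 a10 a01 a11 a02 b00 b10 b01 b11 b02 !addr0.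
  by split=> //; rewrite mulrDr addrACA a20 b20 addr0.
move=> r a [a00 a10 a01 [a11 a02] a20].
rewrite /critI !xycoefM !big_ord_recl !big_ord0 /= !subn0 ?subSS ?subnn.
rewrite a00 a10 a01 a11 a02 !(mulr0, addr0, add0r); split=> //.
(* Only r_00 a_20 and r_00 a_12 survive in the two products, so the last condition is just
   multiplied by r_00. *)
rewrite -[RHS](mulr0 (xycoef 0 0 r)) -a20.
by rewrite mulrDr; congr (_ + _); rewrite mulrCA.
Qed.

Lemma monomial3E (D : idomainType) (m : 'X_{1..3}) :
  'X_[m] = 'X_0 ^+ m 0 * 'X_1 ^+ m 1 * 'X_2 ^+ m 2 :> {mpoly D[3]}.
Proof.
rewrite mpolyXE_id !big_ord_recl big_ord0 mulr1 mulrA.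
by congr ('X_ _ ^+ m _ * 'X_ _ ^+ m _ * 'X_ _ ^+ m _); apply: val_inj.
Qed.

Lemma embz_monomial (k : fieldType) c l :
  embz (c *: 'X^l : {poly k}) = c%:MP * 'X_2 ^+ l.
Proof.
by rewrite /embz map_polyZ map_polyXn /= hornerZ hornerXn.
Qed.

Lemma mpoly3_ind (k : fieldType) (Q : {mpoly k[3]} -> Prop) :
  Q 0 -> (forall p q, Q p -> Q q -> Q (p + q)) ->
  (forall A i j, Q (embz A * 'X_0 ^+ i * 'X_1 ^+ j)) -> forall p, Q p.
Proof.
move=> Q0 QD QM p; rewrite (mpolyE p); apply: big_ind => // m _.
rewrite -mul_mpolyC monomial3E.
have -> : (p@_m)%:MP * ('X_0 ^+ m 0 * 'X_1 ^+ m 1 * 'X_2 ^+ m 2) =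
  embz (p@_m *: 'X^(m 2)) * 'X_0 ^+ m 0 * 'X_1 ^+ m 1.
  by rewrite embz_monomial; ring.
exact: QM.
Qed.

Lemma ideal_gen_mull (R : comNzRingType) (s : seq R) g r :
  g \in s -> ideal_gen s (r * g).
Proof. by case: (ideal_gen_is_ideal s) => _ _ IM /ideal_gen_mem /IM. Qed.

Lemma gensI_critI (k : fieldType) n (p : {mpoly k[3]}) :
  ideal_gen (gensI k n) p -> critI n p.
Proof.
(* An explicit coefficient [embz 1] brings the generators into the shape that [xycoef_monomial]
   expects. *)
have emb1 (a : {mpoly k[3]}) : a = embz 1 * a by rewrite rmorph1 mul1r.
apply: ideal_gen_sub (critI_is_ideal k n) _ _ => g.
rewrite !inE => /or4P[] /eqP ->.
- rewrite -['X_0 ^+ 3]mulr1 -(expr0 'X_1) ['X_0 ^+ 3]emb1.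
  by rewrite /critI !xycoef_monomial /= mulr0 addr0.
- rewrite -['X_1 ^+ 3]mul1r -(expr0 'X_0) ['X_0 ^+ 0]emb1.
  by rewrite /critI !xycoef_monomial /= mulr0 addr0.
- rewrite -['X_1]expr1 ['X_0 ^+ 2]emb1.
  by rewrite /critI !xycoef_monomial /= mulr0 addr0.
have -> : 'X_0 ^+ 2 * 'X_2 ^+ n - 'X_0 * 'X_1 ^+ 2 =
    embz 'X^n * 'X_0 ^+ 2 * 'X_1 ^+ 0 + embz (-1) * 'X_0 ^+ 1 * 'X_1 ^+ 2
    :> {mpoly k[3]}.
  rewrite -['X^n]scale1r embz_monomial rmorphN !rmorph1; ring.
rewrite /critI !xycoefD !xycoef_monomial /= !addr0 add0r.
by split=> //; rewrite mulrN1 addrN.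
Qed.

(** Modulo I, p equals a normal form in the six basis monomials. The normal form inherits the
    criterion from p, and there the criterion forces all six coefficients to vanish. *)
Lemma critI_gensI (k : fieldType) n (p : {mpoly k[3]}) :
  critI n p -> ideal_gen (gensI k n) p.
Proof.
set I := ideal_gen _.
have [I0 ID IM] : is_ideal I by apply: ideal_gen_is_ideal.
pose nf (A B C D E F : {poly k}) : {mpoly k[3]} :=
  embz A * 'X_0 ^+ 0 * 'X_1 ^+ 0 + embz B * 'X_0 ^+ 1 * 'X_1 ^+ 0 +
  embz C * 'X_0 ^+ 0 * 'X_1 ^+ 1 + embz D * 'X_0 ^+ 2 * 'X_1 ^+ 0 +
  embz E * 'X_0 ^+ 1 * 'X_1 ^+ 1 + embz F * 'X_0 ^+ 0 * 'X_1 ^+ 2.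
have [A [B [C [D [E [F hp]]]]]] : exists A B C D E F, I (p - nf A B C D E F).
  move: p; apply: mpoly3_ind.
  - by exists 0, 0, 0, 0, 0, 0; rewrite /nf rmorph0 !mul0r !addr0 subr0.
  - move=> p q [A [B [C [D [E [F hp]]]]]] [A' [B' [C' [D' [E' [F' hq]]]]]].
    exists (A + A'), (B + B'), (C + C'), (D + D'), (E + E'), (F + F').
    have := ID _ _ hp hq; congr I; rewrite /nf !rmorphD /=; ring.
  (* A multiple of a generator has normal form 0; this settles every monomial except the six basis
     ones and x y^2. *)
  have multiple g q r : g \in gensI k n -> r = q * g ->
      exists A B C D E F, I (r - nf A B C D E F).
    move=> Ig ->; exists 0, 0, 0, 0, 0, 0; rewrite /nf rmorph0 !mul0r !addr0.
    by rewrite subr0; apply: ideal_gen_mull.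
  move=> A i j; case: (leqP 3 i) => [le3i | ].
    apply: (multiple ('X_0 ^+ 3) (embz A * 'X_0 ^+ (i - 3) * 'X_1 ^+ j)).
      by rewrite !inE eqxx.
    by rewrite -{1}(subnK le3i) exprD; ring.
  case: (leqP 3 j) => [le3j _ | ].
    apply: (multiple ('X_1 ^+ 3) (embz A * 'X_0 ^+ i * 'X_1 ^+ (j - 3))).
      by rewrite !inE eqxx ?orbT.
    by rewrite -{1}(subnK le3j) exprD; ring.
  have x2yI : 'X_0 ^+ 2 * 'X_1 \in gensI k n by rewrite !inE eqxx ?orbT.
  case: j => [|[|[|//]]] _; case: i => [|[|[|//]]] _.
  - by exists A, 0, 0, 0, 0, 0; rewrite /nf rmorph0 !mul0r !addr0 subrr.
  - by exists 0, A, 0, 0, 0, 0; rewrite /nf rmorph0 !mul0r ?addr0 ?add0r subrr.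
  - by exists 0, 0, 0, A, 0, 0; rewrite /nf rmorph0 !mul0r ?addr0 ?add0r subrr.
  - by exists 0, 0, A, 0, 0, 0; rewrite /nf rmorph0 !mul0r ?addr0 ?add0r subrr.
  - by exists 0, 0, 0, 0, A, 0; rewrite /nf rmorph0 !mul0r ?addr0 ?add0r subrr.
  - by apply: (multiple _ (embz A) _ x2yI); ring.
  - by exists 0, 0, 0, 0, 0, A; rewrite /nf rmorph0 !mul0r ?addr0 ?add0r subrr.
  (* The last generator replaces x y^2 by z^n x^2. *)
  - exists 0, 0, 0, (A * 'X^n), 0, 0.
    have -> : embz A * 'X_0 ^+ 1 * 'X_1 ^+ 2 - nf 0 0 0 (A * 'X^n) 0 0 =
      (- embz A) * ('X_0 ^+ 2 * 'X_2 ^+ n - 'X_0 * 'X_1 ^+ 2).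
      by rewrite /nf rmorph0 rmorphM /= -['X^n]scale1r embz_monomial rmorph1;
        ring.
    by apply: ideal_gen_mull; rewrite !inE eqxx ?orbT.
  by apply: (multiple _ (embz A * 'X_1) _ x2yI); ring.
move=> Kp.
have [_ KD KM] := critI_is_ideal k n.
(* The normal form is p - (p - nf), a difference of elements satisfying the criterion. It has no x
   y^2 term, so the last condition reads D = 0. *)
have: critI n (nf A B C D E F).
  have := KD _ _ Kp (KM (-1) _ (gensI_critI hp)); congr (critI n _); ring.
rewrite /critI /nf !xycoefD !xycoef_monomial /= ?(mulr0, addr0, add0r).
case=> A0 B0 C0 [E0 F0] D0; move: hp.
by rewrite A0 B0 C0 D0 E0 F0 /nf rmorph0 !mul0r !addr0 subr0.
Qed.

(** * Primarity of I *)

(** If p lies in (x, y), then p^4 lies in (x, y)^4, whereas the criterion only involves coefficients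
    of degree at most 3 in x and y. Squaring twice keeps the expanded convolutions short. *)
Lemma critI_exp4 (k : fieldType) n (p : {mpoly k[3]}) :
  xycoef 0 0 p = 0 -> critI n (p ^+ 4).
Proof.
move=> p00; rewrite (exprM p 2 2) !expr2 /critI.
have mul_ord1 (q r : {mpoly k[3]}) : xycoef 0 0 q = 0 -> xycoef 0 0 r = 0 ->
  [/\ xycoef 0 0 (q * r) = 0, xycoef 1 0 (q * r) = 0 & xycoef 0 1 (q * r) = 0].
  move=> q0 r0; rewrite !xycoefM !big_ord_recl !big_ord0 /= ?subnn.
  by rewrite q0 r0 !(mulr0, mul0r, addr0).
have [q00 q10 q01] := mul_ord1 p p p00 p00.
move: (p * p) q00 q10 q01 => q q00 q10 q01.
rewrite !xycoefM !big_ord_recl !big_ord0 /= !subn0 ?subSS ?subnn.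
by rewrite q00 q10 q01 !(mulr0, mul0r, addr0, add0r).
Qed.

(** The conditions on p q form a triangular system in the coefficients of p with q_00 on the
    diagonal. Once the lower coefficients of p vanish, the last condition is q_00 (p_20 + z^n p_12)
    = 0 in the domain k[z]. *)
Lemma critI_torsion_free (k : fieldType) n (p q : {mpoly k[3]}) :
  critI n (p * q) -> xycoef 0 0 q != 0 -> critI n p.
Proof.
have mul_eq0 (A : {poly k}) : xycoef 0 0 q != 0 ->
    A * xycoef 0 0 q = 0 -> A = 0.
  by move=> q0 /eqP; rewrite mulf_eq0 (negbTE q0) orbF => /eqP.
move=> Kpq /mul_eq0 {}mul_eq0; move: Kpq.
rewrite /critI !xycoefM !big_ord_recl !big_ord0 /= /bump !leq0n !add1n.
rewrite !subn0 ?subSS ?subnn !addr0.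
case=> /mul_eq0 ->; rewrite !mul0r !add0r => /mul_eq0 -> /mul_eq0 ->.
rewrite !mul0r !add0r => -[/mul_eq0 -> /mul_eq0 ->].
rewrite !mul0r !add0r => h; split=> //; apply: mul_eq0.
by rewrite -h mulrDl mulrA.
Qed.

Lemma gensI_primary (k : fieldType) n : primary_ideal (ideal_gen (gensI k n)).
Proof.
split; first exact: ideal_gen_is_ideal.
  case/gensI_critI; rewrite /xycoef rmorph1 !coef1 /= => /eqP.
  by rewrite oner_eq0.
move=> p q /gensI_critI Kpq; have [q0|q0] := eqVneq (xycoef 0 0 q) 0.
  by right; exists 4; split=> //; apply/critI_gensI/critI_exp4.
by left; apply/critI_gensI/(critI_torsion_free Kpq).
Qed.

(** * The integral closure of I *)

(** These weights define supporting planes of the Newton polyhedron of J: y^3 and x^2 z^n attain the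
    bound 6 for [wtxy], and all five generators attain the bound 3n for [wtxyz]. *)
Definition wtxy (i : 'I_3) : nat := nth 0 [:: 3; 2; 0] i.

Definition wtxyz n (i : 'I_3) : nat := nth 0 [:: n; n; 1] i.

Lemma gensJ_ord_ge (k : fieldType) n (p : {mpoly k[3]}) :
  ideal_gen (gensJ k n) p -> ord_ge wtxy 6 p /\ ord_ge (wtxyz n) (3 * n) p.
Proof.
move=> Jp; split;
  refine (ideal_gen_sub (@ord_ge_is_ideal k 3 _ _) _ Jp) => g;
  rewrite !inE => /or4P[|||/orP[]] /eqP ->; rewrite /ord_ge;
  first [rewrite rmorphXn | rewrite rmorphM ?rmorphXn] => /=;
  rewrite ?rmorphXn /= !wsubstX /wtxy /wtxyz /=.
- by exists ('X^3 * ('X_0)%:P ^+ 3); ring.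
- by exists (('X_1)%:P ^+ 3); ring.
- by exists ('X^2 * ('X_0)%:P ^+ 2 * ('X_1)%:P); ring.
- by exists (('X_0)%:P ^+ 2 * ('X_2)%:P ^+ n); rewrite expr0 mulr1; ring.
- by exists ('X * ('X_0)%:P * ('X_1)%:P ^+ 2); ring.
- by exists (('X_0)%:P ^+ 3); rewrite exprMn -exprM mulnC mulrC.
- by exists (('X_1)%:P ^+ 3); rewrite exprMn -exprM mulnC mulrC.
- by exists (('X_0)%:P ^+ 2 * ('X_1)%:P); rewrite !mulSn mul0n !exprD; ring.
- exists (('X_0)%:P ^+ 2 * ('X_2)%:P ^+ n).
  by rewrite !mulSn mul0n !exprD !exprMn; ring.
by exists (('X_0)%:P * ('X_1)%:P ^+ 2); rewrite !mulSn mul0n !exprD; ring.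
Qed.

Lemma ord_ge_gensJ (k : fieldType) n (p : {mpoly k[3]}) : (0 < n)%N ->
  ord_ge wtxy 6 p -> ord_ge (wtxyz n) (3 * n) p -> ideal_gen (gensJ k n) p.
Proof.
move=> n0 p1 p2; rewrite (mpolyE p).
apply: is_ideal_sum (ideal_gen_is_ideal _) _ => m mp.
move: (ord_ge_msupp p1 mp) (ord_ge_msupp p2 mp).
rewrite /wt !big_ord_recl !big_ord0 /wtxy /wtxyz /= -mul_mpolyC monomial3E.
have -> : lift ord0 ord0 = 1 :> 'I_3 by apply: val_inj.
have -> : lift ord0 (lift ord0 ord0) = 2 :> 'I_3 by apply: val_inj.
have -> : ord0 = 0 :> 'I_3 by [].
move: (m 0) (m 1) (m 2) (p@_m)%:MP => i j l c le1 le2.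
have multiple g q r : g \in gensJ k n -> r = q * g -> ideal_gen (gensJ k n) r.
  by move=> Jg ->; apply: ideal_gen_mull.
have [le3i | lti3] := leqP 3 i.
  apply: (multiple ('X_0 ^+ 3) (c * 'X_0 ^+ (i - 3) * 'X_1 ^+ j * 'X_2 ^+ l)).
    by rewrite !inE eqxx.
  by rewrite -{1}(subnK le3i) exprD; ring.
have [le3j | ltj3] := leqP 3 j.
  apply: (multiple ('X_1 ^+ 3) (c * 'X_0 ^+ i * 'X_1 ^+ (j - 3) * 'X_2 ^+ l)).
    by rewrite !inE eqxx ?orbT.
  by rewrite -{1}(subnK le3j) exprD; ring.
(* Now i, j < 3. If j = 0, then 3i >= 6 gives i = 2, and 2n + l >= 3n gives l >= n. *)
have [j0 | j_gt0] := posnP j.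
  have i2 : i = 2 by lia.
  have le_nl : (n <= l)%N by nia.
  apply: (multiple ('X_0 ^+ 2 * 'X_2 ^+ n) (c * 'X_2 ^+ (l - n))).
    by rewrite !inE eqxx ?orbT.
  by rewrite -{1}(subnK le_nl) exprD i2 j0; ring.
have [i2 | ltilt2] := eqVneq i 2.
  apply: (multiple ('X_0 ^+ 2 * 'X_1) (c * 'X_1 ^+ j.-1 * 'X_2 ^+ l)).
    by rewrite !inE eqxx ?orbT.
  by rewrite i2 -{1}(prednK j_gt0) exprS; ring.
(* With i <= 1 and j <= 2, the bound 3i + 2j >= 6 leaves only this case. *)
have [-> ->] : i = 1 /\ j = 2 by lia.
apply: (multiple ('X_0 * 'X_1 ^+ 2) (c * 'X_2 ^+ l)).
  by rewrite !inE eqxx ?orbT.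
by ring.
Qed.

Lemma gensI_gensJ (k : fieldType) n (p : {mpoly k[3]}) :
  ideal_gen (gensI k n) p -> ideal_gen (gensJ k n) p.
Proof.
have [_ JD _] := ideal_gen_is_ideal (gensJ k n).
refine (ideal_gen_sub (ideal_gen_is_ideal _) _ (r:=_)) => g.
rewrite !inE => /or4P[] /eqP ->.
1-3: by apply: ideal_gen_mem; rewrite !inE eqxx ?orbT.
rewrite -mulN1r; apply: JD; last apply: ideal_gen_mull.
  by apply: ideal_gen_mem; rewrite !inE eqxx ?orbT.
by rewrite !inE eqxx ?orbT.
Qed.

Lemma integral_closure_gensI (k : fieldType) n (p : {mpoly k[3]}) : (0 < n)%N ->
  integral_closure (ideal_gen (gensI k n)) p <-> ideal_gen (gensJ k n) p.
Proof.
move=> n0; split=> [clp | Jp].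
  by apply: ord_ge_gensJ => //; apply: ord_ge_integral clp => q;
    move=> /gensI_gensJ /gensJ_ord_ge[].
have [I0 ID IM] := ideal_gen_is_ideal (gensI k n).
(* J = I + (x y^2), because x^2 z^n is the last generator of I plus x y^2. *)
have [q [r [Iq ->]]] : exists q r,
    ideal_gen (gensI k n) q /\ p = q + r * ('X_0 * 'X_1 ^+ 2).
  move: p Jp; apply: ideal_gen_sub; first split.
  - by exists 0, 0; rewrite mul0r addr0.
  - move=> _ _ [q [r [Iq ->]]] [q' [r' [Iq' ->]]].
    by exists (q + q'), (r + r'); split; [apply: ID | ring].
  - move=> a _ [q [r [Iq ->]]].
    by exists (a * q), (a * r); split; [apply: IM | ring].
  move=> g; rewrite !inE => /or4P[|||/orP[]] /eqP ->.
  1-3: by eexists _, 0; split; last (by rewrite mul0r addr0);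
    apply: ideal_gen_mem; rewrite !inE eqxx ?orbT.
  - exists ('X_0 ^+ 2 * 'X_2 ^+ n - 'X_0 * 'X_1 ^+ 2), 1; split; last by ring.
    by apply: ideal_gen_mem; rewrite !inE eqxx ?orbT.
  by exists 0, 1; rewrite add0r mul1r.
apply: integral_sqr_add => //.
have -> : (r * ('X_0 * 'X_1 ^+ 2)) ^+ 2 =
  (r ^+ 2 * ('X_0 ^+ 2 * 'X_1)) * 'X_1 ^+ 3 by ring.
apply: ideal_exp2; last by apply: ideal_gen_mem; rewrite !inE eqxx ?orbT.
by apply: ideal_gen_mull; rewrite !inE eqxx ?orbT.
Qed.

(** * Failure of primarity for J *)

(** The product x^2 z^n lies in J, but x^2 has [wtxyz] weight 2n < 3n, and every power of z has
    [wtxy] weight 0 < 6. *)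
Lemma gensJ_not_primary (k : fieldType) n : (0 < n)%N ->
  ~ primary_ideal (ideal_gen (gensJ k n)).
Proof.
move=> n0 [_ _ prJ].
have suppX (i : 'I_3) m : ((U_(i) *+ m)%MM : 'X_{1..3}) \in
    msupp ('X_i ^+ m : {mpoly k[3]}).
  by rewrite mcoeff_msupp mpolyXn mcoeffX eqxx oner_eq0.
have wtX (w : 'I_3 -> nat) i m : wt w (U_(i) *+ m)%MM = (w i * m)%N.
  rewrite /wt (bigD1 i) //= big1 ?addn0 => [|j /negbTE ne_ji].
    by rewrite mulmnE mnm1E eqxx mul1n.
  by rewrite mulmnE mnm1E eq_sym ne_ji mul0n muln0.
have /prJ : ideal_gen (gensJ k n) ('X_0 ^+ 2 * 'X_2 ^+ n).
  by apply: ideal_gen_mem; rewrite !inE eqxx ?orbT.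
case=> [/gensJ_ord_ge[_]|[m [_]]].
  by move/ord_ge_msupp/(_ (suppX _ _)); rewrite wtX /wtxyz /=; lia.
rewrite -exprM => /gensJ_ord_ge[/ord_ge_msupp/(_ (suppX _ _)) + _].
by rewrite wtX /wtxy /= mul0n.
Qed.

Theorem theorem3p2 (k : fieldType) (n : nat) (n_gt0 : (0 < n)%N) :
  let x : {mpoly k[3]} := 'X_0 in
  let y : {mpoly k[3]} := 'X_1 in
  let z : {mpoly k[3]} := 'X_2 in
  let I := ideal_gen [:: x ^+ 3; y ^+ 3; x ^+ 2 * y;
                         x ^+ 2 * z ^+ n - x * y ^+ 2] in
  let J := ideal_gen [:: x ^+ 3; y ^+ 3; x ^+ 2 * y;
                         x ^+ 2 * z ^+ n; x * y ^+ 2] in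
  [/\ primary_ideal I,
      forall p : {mpoly k[3]}, integral_closure I p <-> J p
    & ~ primary_ideal J].
Proof.
split; first exact: gensI_primary.
  by move=> p; apply: integral_closure_gensI.
exact: gensJ_not_primary.
Qed.
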